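(* Let $M\ge N\ge 1$ and $1\le E\le D$ be integers. Let $[A]_{D+E}=[A]_D+[\Delta A]_E\,t^D$ with $[A]_D=\sum_{d=0}^{D-1}A_dt^d$, $[\Delta A]_E=\sum_{d=0}^{E-1}A_{D+d}t^d$ and $A_d\in\mathbb R^{M\times N}$. Let $[Q]_D=\sum_{d=0}^{D-1}Q_dt^d$ ($Q_d\in\mathbb R^{M\times N}$) and $[R]_D=\sum_{d=0}^{D-1}R_dt^d$ ($R_d\in\mathbb R^{N\times N}$) satisfy $$[Q]_D[R]_D\stackrel{D}{=}[A]_D,\qquad [Q]_D^T[Q]_D\stackrel{D}{=}I,\qquad P_L\circ[R]_D\stackrel{D}{=}0,$$ and assume that $R_0$ is invertible. Define successively: 1. $[\Delta F]_E$ and $[\Delta G]_E$ by $[\Delta F]_E\,t^D\stackrel{D+E}{=}[Q]_D[R]_D-[A]_D$ and $[\Delta G]_E\,t^D\stackrel{D+E}{=}I-[Q]_D^T[Q]_D$; 2. $[H]_E\stackrel{E}{=}[\Delta A]_E-[\Delta F]_E$ and $[S]_E\stackrel{E}{=}\tfrac12[\Delta G]_E$; 3. $[X]_E$ as the antisymmetric matrix polynomial ($[X]_E^T=-[X]_E$) determined by $P_L\circ[X]_E\stackrel{E}{=}P_L\circ\big([Q]_E^T[H]_E[R]_E^{-1}\big)-P_L\circ[S]_E$; 4. $[K]_E\stackrel{E}{=}[S]_E+[X]_E$; 5. $[\Delta R]_E\stackrel{E}{=}[Q]_E^T[H]_E-[K]_E[R]_E$; 6. $[\Delta Q]_E\stackrel{E}{=}\big([H]_E-[Q]_E[\Delta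 R]_E\big)[R]_E^{-1}$. Then $[Q]_{D+E}:=[Q]_D+[\Delta Q]_E\,t^D$ and $[R]_{D+E}:=[R]_D+[\Delta R]_E\,t^D$ satisfy $$[Q]_{D+E}[R]_{D+E}\stackrel{D+E}{=}[A]_{D+E},\qquad [Q]_{D+E}^T[Q]_{D+E}\stackrel{D+E}{=}I,\qquad P_L\circ[R]_{D+E}\stackrel{D+E}{=}0 .$$
   Context: For polynomials (or power series) in $t$ with matrix coefficients, $\stackrel{D}{=}$ means equality of the coefficients of $t^0,\dots,t^{D-1}$, i.e. equality modulo $t^D$. $[X]_D$ denotes a matrix polynomial of degree at most $D-1$ in $t$ with real matrix coefficients, representing an element modulo $t^D$. For $E\le D$, $[X]_E$ denotes the truncation of $[X]_D$ modulo $t^E$. $[R]_E^{-1}$ is the inverse of $[R]_E$ modulo $t^E$. The transpose and the Hadamard (entrywise) product $\circ$ with a constant matrix act coefficientwise. $P_L\in\mathbb R^{N\times N}$ is the matrix with $(P_L)_{ij}=1$ if $i>j$ and $0$ otherwise, so $P_L\circ R=0$ means that $R$ is upper triangular. $I$ is the $N\times N$ identity matrix. *)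

(* Defs.v *)
From HB Require Import structures.
From mathcomp Require Import all_boot all_order all_algebra.
From mathcomp Require Import reals.

Set Implicit Arguments.
Unset Strict Implicit.
Unset Printing Implicit Defensive.

Import Order.TTheory GRing.Theory Num.Theory.
Local Open Scope ring_scope.

(* Matrix polynomials in t are represented as matrices with entries in
   {poly R}: the variable t is 'X, and this also covers rectangular
   coefficients, for which there is no type {poly 'M_(m, n)}. *)

Definition mxcoef (R : nzRingType) (m n d : nat) (A : 'M[{poly R}]_(m, n)) :
  'M[R]_(m, n) := map_mx (fun p : {poly R} => p`_d) A.

Definition mxpoly_sum (R : nzRingType) (m n D : nat)
  (a : nat -> 'M[R]_(m, n)) : 'M[{poly R}]_(m, n) :=
  \sum_(d < D) 'X^d *: map_mx polyC (a d).

Definition mxtrunc (R : nzRingType) (m n E : nat) (A : 'M[{poly R}]_(m, n)) :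
  'M[{poly R}]_(m, n) := map_mx (take_poly E) A.

Definition mxdeg_lt (R : nzRingType) (m n D : nat) (A : 'M[{poly R}]_(m, n)) :
  Prop := forall i j, (size (A i j) <= D)%N.

Definition mxeq_mod (R : nzRingType) (m n D : nat)
  (A B : 'M[{poly R}]_(m, n)) : Prop :=
  forall d : nat, (d < D)%N -> mxcoef d A = mxcoef d B.

Notation "A =[ D ] B" := (mxeq_mod D A B)
  (at level 70, D at level 200, no associativity) : ring_scope.

Definition is_inv_mod (R : nzRingType) (n E : nat)
  (A B : 'M[{poly R}]_n) : Prop :=
  [/\ mxdeg_lt E B, A *m B =[E] 1%:M & B *m A =[E] 1%:M].

Definition hadamard (R : nzRingType) (m n : nat)
  (C : 'M[R]_(m, n)) (A : 'M[{poly R}]_(m, n)) : 'M[{poly R}]_(m, n) :=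
  map2_mx (fun (c : R) (p : {poly R}) => c *: p) C A.

Definition PL (R : nzRingType) (n : nat) : 'M[R]_n :=
  \matrix_(i < n, j < n) (j < i)%N%:R.

(* All the quantities introduced by one lifting step from order D to D + E;
   l_invR stands for the inverse of [R]_E modulo t^E. *)
Record lifting (R : nzRingType) (M N : nat) := Lifting {
  l_invR : 'M[{poly R}]_N;
  l_dF : 'M[{poly R}]_(M, N);
  l_dG : 'M[{poly R}]_N;
  l_H : 'M[{poly R}]_(M, N);
  l_S : 'M[{poly R}]_N;
  l_X : 'M[{poly R}]_N;
  l_K : 'M[{poly R}]_N;
  l_dR : 'M[{poly R}]_N;
  l_dQ : 'M[{poly R}]_(M, N)
}.

(* The equations only hold modulo powers of t; the degree bounds make each
   quantity a genuine representative [.]_E, hence uniquely determined. *)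
Record lifting_steps (R : realType) (M N D E : nat)
  (AD dA QD : 'M[{poly R}]_(M, N)) (RD : 'M[{poly R}]_N)
  (s : lifting R M N) : Prop := LiftingSteps {
  ls_invR : is_inv_mod E (mxtrunc E RD) (l_invR s);
  ls_dF_deg : mxdeg_lt E (l_dF s);
  ls_dF : 'X^D *: l_dF s =[D + E] QD *m RD - AD;
  ls_dG_deg : mxdeg_lt E (l_dG s);
  ls_dG : 'X^D *: l_dG s =[D + E] 1%:M - QD^T *m QD;
  ls_H_deg : mxdeg_lt E (l_H s);
  ls_H : l_H s =[E] dA - l_dF s;
  ls_S_deg : mxdeg_lt E (l_S s);
  ls_S : l_S s =[E] (2^-1 : R)%:P *: l_dG s;
  ls_X_deg : mxdeg_lt E (l_X s);
  ls_X_antisym : (l_X s)^T = - l_X s;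
  ls_X : hadamard (PL R N) (l_X s)
    =[E] hadamard (PL R N) ((mxtrunc E QD)^T *m l_H s *m l_invR s)
         - hadamard (PL R N) (l_S s);
  ls_K_deg : mxdeg_lt E (l_K s);
  ls_K : l_K s =[E] l_S s + l_X s;
  ls_dR_deg : mxdeg_lt E (l_dR s);
  ls_dR : l_dR s
    =[E] (mxtrunc E QD)^T *m l_H s - l_K s *m mxtrunc E RD;
  ls_dQ_deg : mxdeg_lt E (l_dQ s);
  ls_dQ : l_dQ s
    =[E] (l_H s - mxtrunc E QD *m l_dR s) *m l_invR s
}.

(* Main.v *)
Require Import Defs.
From HB Require Import structures.
From mathcomp Require Import all_boot all_order all_algebra.
From mathcomp Require Import reals.
From Corelib Require Import Setoid Morphisms.

Set Implicit Arguments.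
Unset Strict Implicit.
Unset Printing Implicit Defensive.

Import Order.TTheory GRing.Theory Num.Theory.
Local Open Scope ring_scope.

(* Since E <= D, the products of two corrections are O(t^(D + E)), so modulo
   t^(D + E) the three equations for the lifted factors reduce to three linear
   equations modulo t^E:
     dQ R + Q dR = H,   dQ^T Q + Q^T dQ = dG,   P_L o dR = 0.
   The first one is the definition of dQ. It implies Q^T dQ = K, and
   K + K^T = S + S^T = dG because dG is symmetric and X antisymmetric. Finally
   dR = (Q^T H R^-1 - K) R is a product of two upper triangular matrices, by the
   choice of X. *)

(** * Calculus of congruences modulo [t^D], set up for rewriting *)

Section Congruence.
Variables (R : comNzRingType).
Implicit Types (m n p D E : nat).

(** Divisibility form of the congruence: compatibility with sums, products, transposes and scaling
    then amounts to exhibiting a cofactor of ['X^D]. *)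
Lemma mxeq_modP m n D (A B : 'M[{poly R}]_(m, n)) :
  A =[D] B <-> exists C, A = B + 'X^D *: C.
Proof.
split=> [eqAB | [C ->] d ltdD].
  exists (map_mx (drop_poly D) (A - B)); apply/matrixP=> i j; rewrite !mxE.
  have := poly_take_drop D (A i j - B i j).
  suff -> : take_poly D (A i j - B i j) = 0.
    by rewrite add0r mulrC => ->; rewrite addrC subrK.
  apply/polyP=> d; rewrite coef_take_poly coef0 coefB; case: ifP => // ltdD.
  by move/matrixP/(_ i j): (eqAB d ltdD); rewrite !mxE => ->; rewrite subrr.
by apply/matrixP=> i j; rewrite !mxE coefD coefXnM ltdD addr0.
Qed.

#[export] Instance mxeq_mod_equiv m n D :
  Equivalence (@mxeq_mod R m n D).
Proof.
split=> [A // | A B eqAB d ltdD | A B C eqAB eqBC d ltdD].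
  by rewrite eqAB.
by rewrite eqAB ?eqBC.
Qed.

#[export] Instance mxeq_mod_addr m n D :
  Proper (mxeq_mod D ==> mxeq_mod D ==> mxeq_mod D)
    (fun A B : 'M[{poly R}]_(m, n) => A + B).
Proof.
move=> _ A' /mxeq_modP[C ->] _ B' /mxeq_modP[C' ->]; apply/mxeq_modP.
by exists (C + C'); rewrite addrACA scalerDr.
Qed.

#[export] Instance mxeq_mod_oppr m n D :
  Proper (mxeq_mod D ==> mxeq_mod D)
    (fun A : 'M[{poly R}]_(m, n) => - A).
Proof.
move=> _ A' /mxeq_modP[C ->]; apply/mxeq_modP.
by exists (- C); rewrite opprD scalerN.
Qed.

#[export] Instance mxeq_mod_mulmx m n p D :
  Proper (mxeq_mod D ==> mxeq_mod D ==> mxeq_mod D)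
    (@mulmx {poly R} m n p).
Proof.
move=> _ A /mxeq_modP[C ->] _ B /mxeq_modP[C' ->]; apply/mxeq_modP.
exists (A *m C' + C *m (B + 'X^D *: C')).
by rewrite mulmxDl mulmxDr scalerDr addrA -scalemxAl -scalemxAr.
Qed.

#[export] Instance mxeq_mod_trmx m n D :
  Proper (mxeq_mod D ==> mxeq_mod D) (@trmx {poly R} m n).
Proof.
move=> _ A' /mxeq_modP[C ->]; apply/mxeq_modP.
by exists C^T; rewrite linearD linearZ.
Qed.

#[export] Instance mxeq_mod_scale m n D (c : {poly R}) :
  Proper (mxeq_mod D ==> mxeq_mod D) (fun A : 'M[{poly R}]_(m, n) => c *: A).
Proof.
move=> _ A' /mxeq_modP[C ->]; apply/mxeq_modP.
by exists (c *: C); rewrite scalerDr !scalerA mulrC.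
Qed.


Lemma mxeq_mod_leq m n D E (A B : 'M[{poly R}]_(m, n)) :
  (E <= D)%N -> A =[D] B -> A =[E] B.
Proof. by move=> leED eqAB d ltdE; apply: eqAB; apply: leq_trans leED. Qed.

Lemma mxeq_mod_scaleXn m n D E (A B : 'M[{poly R}]_(m, n)) :
  'X^D *: A =[D + E] 'X^D *: B <-> A =[E] B.
Proof.
split=> [eqAB d ltdE | /mxeq_modP[C ->]].
  apply/matrixP=> i j; have := eqAB (D + d)%N.
  rewrite ltn_add2l => /(_ ltdE)/matrixP/(_ i j).
  by rewrite !mxE !coefXnM ltnNge leq_addr addKn.
by apply/mxeq_modP; exists C; rewrite scalerDr scalerA -exprD.
Qed.

Lemma mulmx_lift m n p D E (A B : 'M[{poly R}]_(m, n)) (C F : 'M_(n, p)) :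
  (E <= D)%N ->
  (A + 'X^D *: B) *m (C + 'X^D *: F) =[D + E]
    A *m C + 'X^D *: (B *m C + A *m F).
Proof.
(* The discarded term is [t^(2D) B F], and [2D = (D + E) + (D - E)]. *)
move=> leED; apply/mxeq_modP; exists ('X^(D - E) *: (B *m F)).
rewrite mulmxDl !mulmxDr -!scalemxAl -!scalemxAr scalerDr !scalerA -!exprD.
by rewrite -addnA subnKC // !addrA (addrAC (A *m C)).
Qed.

Lemma mxtrunc_mod m n E (A : 'M[{poly R}]_(m, n)) : mxtrunc E A =[E] A.
Proof.
by move=> d ltdE; apply/matrixP=> i j; rewrite !mxE coef_take_poly ltdE.
Qed.

Lemma mxtrunc_deg m n E (A : 'M[{poly R}]_(m, n)) : mxdeg_lt E (mxtrunc E A).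
Proof. by move=> i j; rewrite mxE size_take_poly. Qed.

Lemma mxdeg_lt_inj m n E (A B : 'M[{poly R}]_(m, n)) :
  mxdeg_lt E A -> mxdeg_lt E B -> A =[E] B -> A = B.
Proof.
move=> degA degB eqAB; apply/matrixP=> i j; apply/polyP=> d.
have [ltdE | leEd] := ltnP d E.
  by move/matrixP/(_ i j): (eqAB d ltdE); rewrite !mxE.
by rewrite !nth_default // (leq_trans _ leEd).
Qed.

Lemma hadamard0 m n (C : 'M[R]_(m, n)) : hadamard C 0 = 0.
Proof. by apply/matrixP=> i j; rewrite !mxE scaler0. Qed.

Lemma hadamardB m n (C : 'M[R]_(m, n)) (A B : 'M_(m, n)) :
  hadamard C (A - B) = hadamard C A - hadamard C B.
Proof. by apply/matrixP=> i j; rewrite !mxE scalerBr. Qed.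

Lemma hadamardD m n (C : 'M[R]_(m, n)) (A B : 'M_(m, n)) :
  hadamard C (A + B) = hadamard C A + hadamard C B.
Proof. by apply/matrixP=> i j; rewrite !mxE scalerDr. Qed.

Lemma hadamardZ m n (C : 'M[R]_(m, n)) c (A : 'M_(m, n)) :
  hadamard C (c *: A) = c *: hadamard C A.
Proof. by apply/matrixP=> i j; rewrite !mxE scalerAr. Qed.

#[export] Instance mxeq_mod_hadamard m n D (C : 'M[R]_(m, n)) :
  Proper (mxeq_mod D ==> mxeq_mod D) (hadamard C).
Proof.
move=> _ A' /mxeq_modP[B ->]; apply/mxeq_modP.
by exists (hadamard C B); rewrite hadamardD hadamardZ.
Qed.

Lemma hadamard_PL_mod n E (A B : 'M[{poly R}]_n) :
  hadamard (PL R n) A =[E] hadamard (PL R n) B <->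
  forall i j : 'I_n, (j < i)%N -> forall d, (d < E)%N ->
    (A i j)`_d = (B i j)`_d.
Proof.
split=> [eqAB i j ltji d ltdE | eqAB d ltdE].
  by move/matrixP/(_ i j): (eqAB d ltdE); rewrite !mxE ltji !scale1r.
apply/matrixP=> i j; rewrite !mxE; case: ltnP => [ltji | _].
  by rewrite !scale1r eqAB.
by rewrite !scale0r.
Qed.

(** For [j < i], each product [A i k * B k j] has a factor strictly below the diagonal: the first if
    [k < i], the second if [j < i <= k]. The coefficient of index [d < E] only involves coefficients
    of index at most [d], where that factor vanishes. *)
Lemma hadamard_PL_mulmx n E (A B : 'M[{poly R}]_n) :
  hadamard (PL R n) A =[E] 0 -> hadamard (PL R n) B =[E] 0 ->
  hadamard (PL R n) (A *m B) =[E] 0.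
Proof.
rewrite -(hadamard0 (PL R n)) => /hadamard_PL_mod upA /hadamard_PL_mod upB.
apply/hadamard_PL_mod=> i j ltji d ltdE.
rewrite !mxE coef_sum coef0 big1 // => k _; rewrite coefM big1 // => a _.
have [ltki | leik] := ltnP k i.
  have ltaE : (a < E)%N := leq_ltn_trans (leq_ord a) ltdE.
  by rewrite (upA i k ltki a ltaE) mxE coef0 mul0r.
have ltaE : (d - a < E)%N := leq_ltn_trans (leq_subr a d) ltdE.
by rewrite (upB k j (leq_trans ltji leik) _ ltaE) mxE coef0 mulr0.
Qed.

End Congruence.

(** * Ingredients of a step: inverses modulo [t^E], residuals, antisymmetric completion *)

Lemma is_inv_mod_exists (F : fieldType) n E (A : 'M[{poly F}]_n) :
  mxcoef 0 A \in unitmx -> exists B, is_inv_mod E A B.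
Proof.
move=> unitA0.
(* [\det A] has a nonzero constant term, hence is coprime to ['X^E]. Its Bezout coefficient [u]
   inverts it modulo [t^E], so [u *: \adj A] inverts [A]. *)
have /Bezout_eq1_coprimepP[[u v] /= Duv] : coprimep (\det A) 'X^E.
  apply: coprimep_expr; rewrite coprimepX /root.
  (* Evaluation at 0 is a ring morphism, so it commutes with the determinant. *)
  have -> : (\det A).[0] = \det (mxcoef 0 A).
    rewrite -[LHS]/(horner_eval 0 (\det A)) -det_map_mx; congr (\det _).
    by apply/matrixP=> i j; rewrite !mxE -horner_coef0.
  by rewrite -unitfE -unitmxE.
have modA : (\det A * u)%:M =[E] (1%:M : 'M_n).
  apply/mxeq_modP; exists (- v)%:M; apply/matrixP=> i j; rewrite !mxE.
  by rewrite mulrnAr -mulrnDl -[in RHS]Duv mulrN (mulrC v) addrK mulrC.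
exists (mxtrunc E (u *: \adj A)); split; first exact: mxtrunc_deg.
  by rewrite mxtrunc_mod -scalemxAr mul_mx_adj scale_scalar_mx mulrC.
by rewrite mxtrunc_mod -scalemxAl mul_adj_mx scale_scalar_mx mulrC.
Qed.

Lemma is_inv_mod_unique (R : comNzRingType) n E (A B C : 'M[{poly R}]_n) :
  is_inv_mod E A B -> is_inv_mod E A C -> B = C.
Proof.
case=> degB _ BA [degC AC _]; apply: (mxdeg_lt_inj degB degC).
by rewrite -[B]mulmx1 -AC mulmxA BA mul1mx.
Qed.

Lemma mxcoef0_sum (R : nzRingType) m n D (a : nat -> 'M[R]_(m, n)) :
  (0 < D)%N -> mxcoef 0 (mxpoly_sum D a) = a 0%N.
Proof.
case: D => // D _; apply/matrixP=> i j.
rewrite !mxE summxE coef_sum big_ord_recl big1 => [|k _].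
  by rewrite !mxE expr0 mul1r coefC addr0.
by rewrite !mxE coefXnM.
Qed.

(** Source of [dF] and [dG]: the residual of an equation valid modulo [t^D] is divisible by [t^D],
    and the quotient is truncated at [E]. *)
Lemma mxeq_mod_shift (R : comNzRingType) m n D E (A B : 'M[{poly R}]_(m, n)) :
  A =[D] B -> exists2 C, mxdeg_lt E C & 'X^D *: C =[D + E] A - B.
Proof.
case/mxeq_modP=> C ->; exists (mxtrunc E C); first exact: mxtrunc_deg.
by rewrite addrC addKr; apply/mxeq_mod_scaleXn/mxtrunc_mod.
Qed.

(** Take the strictly lower part of [Z] minus its transpose; truncation is additive, so it preserves
    antisymmetry. *)
Lemma antisym_PL_exists (R : comNzRingType) n E (Z : 'M[{poly R}]_n) :
  exists X, [/\ mxdeg_lt E X, X^T = - X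
              & hadamard (PL R n) X =[E] hadamard (PL R n) Z].
Proof.
pose Y : 'M_n := \matrix_(i, j) (if (j < i)%N then Z i j else 0).
exists (mxtrunc E (Y - Y^T)); split; first exact: mxtrunc_deg.
  by apply/matrixP=> i j; rewrite !mxE -opprB raddfN.
rewrite mxtrunc_mod; apply/hadamard_PL_mod=> i j ltji d _.
by rewrite !mxE ltji ltnNge (ltnW ltji) subr0.
Qed.

(** Antisymmetry carries the strictly lower entries to the upper ones and forces [2 Z j j = 0] on
    the diagonal, hence [Z j j = 0] in characteristic 0. *)
Lemma antisym_PL_inj (R : numDomainType) n E (X Y : 'M[{poly R}]_n) :
  mxdeg_lt E X -> mxdeg_lt E Y -> X^T = - X -> Y^T = - Y ->
  hadamard (PL R n) X =[E] hadamard (PL R n) Y -> X = Y.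
Proof.
move=> degX degY antiX antiY /hadamard_PL_mod eqXY.
have antiE (Z : 'M[{poly R}]_n) i j : Z^T = - Z -> Z i j = - Z j i.
  by move/matrixP/(_ j i); rewrite !mxE.
apply: (mxdeg_lt_inj degX degY) => d ltdE; apply/matrixP=> i j; rewrite !mxE.
have [ltij | ltji | /val_inj->] := ltngtP i j; last first.
- have diag0 (Z : 'M[{poly R}]_n) : Z^T = - Z -> Z j j = 0.
    move/(antiE _ j j)/eqP; rewrite -addr_eq0 -mulr2n => /eqP Zjj.
    apply/polyP=> k; move/polyP/(_ k)/eqP: Zjj.
    by rewrite coefMn coef0 mulrn_eq0 => /eqP.
  by rewrite !diag0.
- exact: eqXY.
- by rewrite (antiE X) // (antiE Y) // !coefN eqXY.
Qed.

(** * The linearised equations modulo [t^E] and the lifted factorisation *)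

Section LiftingAlgebra.
Variables (R : comNzRingType) (M N D E : nat) (half : R).
Variables (A dA Q H dF dQ : 'M[{poly R}]_(M, N)).
Variables (T B dG S X K dR : 'M[{poly R}]_N).
Hypotheses (half2 : half + half = 1) (leED : (E <= D)%N).
Hypotheses (orthQ : Q^T *m Q =[D] 1%:M) (upT : hadamard (PL R N) T = 0).
Hypotheses (TB : T *m B =[E] 1%:M) (BT : B *m T =[E] 1%:M).
Hypothesis eqF : 'X^D *: dF =[D + E] Q *m T - A.
Hypothesis eqG : 'X^D *: dG =[D + E] 1%:M - Q^T *m Q.
Hypotheses (eqH : H =[E] dA - dF) (eqS : S =[E] half%:P *: dG).
Hypothesis antiX : X^T = - X.
Hypothesis eqX : hadamard (PL R N) X
  =[E] hadamard (PL R N) (Q^T *m H *m B) - hadamard (PL R N) S.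
Hypotheses (eqK : K =[E] S + X) (eqR : dR =[E] Q^T *m H - K *m T).
Hypothesis eqQ : dQ =[E] (H - Q *m dR) *m B.

Lemma lift_correct :
  [/\ (Q + 'X^D *: dQ) *m (T + 'X^D *: dR) =[D + E] A + 'X^D *: dA,
      (Q + 'X^D *: dQ)^T *m (Q + 'X^D *: dQ) =[D + E] 1%:M
    & hadamard (PL R N) (T + 'X^D *: dR) =[D + E] 0].
Proof.
have orthQE := mxeq_mod_leq leED orthQ.
(* Orthogonality gives [Q^T (H - Q dR) = Q^T H - dR = K T], and [B] cancels [T] on the right. *)
have QtdQ : Q^T *m dQ =[E] K.
  rewrite eqQ mulmxA mulmxBr mulmxA orthQE mul1mx.
  by rewrite eqR opprB addrC subrK -mulmxA TB mulmx1.
have lift1 : dQ *m T + Q *m dR =[E] dA - dF.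
  by rewrite eqQ -mulmxA BT mulmx1 subrK eqH.
(* Symmetry is read off after multiplication by [t^D], where [dG] becomes [I - Q^T Q]. *)
have dG_sym : dG^T =[E] dG.
  apply/(mxeq_mod_scaleXn D); rewrite eqG -linearZ /= eqG.
  by rewrite linearB /= trmx1 trmx_mul trmxK.
have lift2 : dQ^T *m Q + Q^T *m dQ =[E] dG.
  rewrite -[dQ^T *m Q]trmxK trmx_mul trmxK QtdQ eqK linearD /= antiX.
  rewrite addrACA addNr addr0 eqS linearZ /= dG_sym -scalerDl -polyCD.
  by rewrite half2 scale1r.
have lift3 : hadamard (PL R N) dR =[E] 0.
  have -> : dR =[E] (Q^T *m H *m B - K) *m T.
    by rewrite eqR mulmxBl -[_ *m B *m T]mulmxA BT mulmx1.
  apply: hadamard_PL_mulmx; last by rewrite upT.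
  (* Below the diagonal, [S] cancels in [K = S + X], leaving [Q^T H B]. *)
  by rewrite hadamardB eqK hadamardD eqX (addrC (hadamard _ S)) subrK subrr.
split.
- rewrite mulmx_lift //; move/(mxeq_mod_scaleXn D): lift1 => ->.
  (* The term [- t^D dF = A - Q T] replaces the old product by [A]. *)
  by rewrite scalerBr eqF opprB addrCA (addrC (Q *m T)) subrK addrC.
- have -> : (Q + 'X^D *: dQ)^T = Q^T + 'X^D *: dQ^T.
    by rewrite linearD linearZ.
  rewrite mulmx_lift //.
  move/(mxeq_mod_scaleXn D): lift2 => ->.
  by rewrite eqG addrC subrK.
- rewrite hadamardD hadamardZ upT add0r.
  by move/(mxeq_mod_scaleXn D): lift3 => ->; rewrite scaler0.
Qed.

End LiftingAlgebra.

(** * Uniqueness, existence and correctness of a lifting step *)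

Section Lifting.
Variables (R : realType) (M N D E : nat).
Variables (A dA Q : 'M[{poly R}]_(M, N)) (T : 'M[{poly R}]_N).

(** Each quantity is fixed modulo [t^E] by the preceding ones, and the degree bounds turn congruence
    into equality; the fields are therefore identified in order of definition. *)
Lemma lifting_steps_unique s s' :
  lifting_steps D E A dA Q T s -> lifting_steps D E A dA Q T s' -> s = s'.
Proof.
case: s s' => [B dF dG H S X K dR dQ] [B' dF' dG' H' S' X' K' dR' dQ'].
case=> /= invB degF eqF degG eqG degH eqH degS eqS degX antiX eqX
  degK eqK degR eqR degQ eqQ.
case=> /= invB' degF' eqF' degG' eqG' degH' eqH' degS' eqS' degX' antiX' eqX'
  degK' eqK' degR' eqR' degQ' eqQ'.
have ? : B = B' := is_inv_mod_unique invB invB'; subst B'.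
have ? : dF = dF'; last subst dF'.
  apply: (mxdeg_lt_inj degF degF').
  by apply/(mxeq_mod_scaleXn D); rewrite eqF eqF'.
have ? : dG = dG'; last subst dG'.
  apply: (mxdeg_lt_inj degG degG').
  by apply/(mxeq_mod_scaleXn D); rewrite eqG eqG'.
have ? : H = H'; last subst H'.
  by apply: (mxdeg_lt_inj degH degH'); rewrite eqH eqH'.
have ? : S = S'; last subst S'.
  by apply: (mxdeg_lt_inj degS degS'); rewrite eqS eqS'.
have ? : X = X'; last subst X'.
  by apply: (antisym_PL_inj degX degX') => //; rewrite eqX eqX'.
have ? : K = K'; last subst K'.
  by apply: (mxdeg_lt_inj degK degK'); rewrite eqK eqK'.
have ? : dR = dR'; last subst dR'.
  by apply: (mxdeg_lt_inj degR degR'); rewrite eqR eqR'.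
by congr Lifting; apply: (mxdeg_lt_inj degQ degQ'); rewrite eqQ eqQ'.
Qed.

Hypotheses (eqQT : Q *m T =[D] A) (orthQ : Q^T *m Q =[D] 1%:M).

Lemma lifting_steps_exists :
  mxcoef 0 (mxtrunc E T) \in unitmx ->
  exists s, lifting_steps D E A dA Q T s.
Proof.
case/(is_inv_mod_exists E) => B invB.
have [dF degF eqF] := mxeq_mod_shift E eqQT.
(* Reversed so that the residual has the sign of [I - Q^T Q]. *)
have orthQ' : 1%:M =[D] Q^T *m Q by rewrite orthQ.
have [dG degG eqG] := mxeq_mod_shift E orthQ'.
pose H := mxtrunc E (dA - dF).
pose S := mxtrunc E ((2^-1 : R)%:P *: dG).
have [X [degX antiX eqX]] :=
  antisym_PL_exists E ((mxtrunc E Q)^T *m H *m B - S).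
pose K := mxtrunc E (S + X).
pose dR := mxtrunc E ((mxtrunc E Q)^T *m H - K *m mxtrunc E T).
pose dQ := mxtrunc E ((H - mxtrunc E Q *m dR) *m B).
exists (Lifting B dF dG H S X K dR dQ).
split=> //=; try exact: mxtrunc_deg; try exact: mxtrunc_mod.
by rewrite -hadamardB.
Qed.

Hypotheses (leED : (E <= D)%N) (upT : hadamard (PL R N) T = 0).

Lemma lifting_steps_correct s : lifting_steps D E A dA Q T s ->
  [/\ (Q + 'X^D *: l_dQ s) *m (T + 'X^D *: l_dR s) =[D + E] A + 'X^D *: dA,
      (Q + 'X^D *: l_dQ s)^T *m (Q + 'X^D *: l_dQ s) =[D + E] 1%:M
    & hadamard (PL R N) (T + 'X^D *: l_dR s) =[D + E] 0].
Proof.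
case: s => [B dF dG H S X K dR dQ].
case=> /= [[_ TB BT] _ eqF _ eqG _ eqH _ eqS _ antiX eqX _ eqK _ eqR _ eqQ].
(* Modulo [t^E] the truncations can be replaced by [Q] and [T] themselves. *)
rewrite !mxtrunc_mod in TB BT eqX eqR eqQ.
apply: (@lift_correct _ _ _ _ _ 2^-1 _ _ _ H dF _ _ B dG S X K) => //.
by rewrite [RHS]splitr !mul1r.
Qed.

End Lifting.

Lemma mxpoly_sum_deg (R : nzRingType) m n D (a : nat -> 'M[R]_(m, n)) :
  mxdeg_lt D (mxpoly_sum D a).
Proof.
move=> i j; rewrite summxE; apply/leq_sizeP=> k leDk; rewrite coef_sum big1 //.
move=> d _; rewrite !mxE coefXnM; case: ltnP => // _.
by rewrite coefC subn_eq0 leqNgt (leq_trans (ltn_ord d)).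
Qed.

Theorem mainTheorem1 (R : realType) (M N D E : nat)
  (hN : (1 <= N)%N) (hNM : (N <= M)%N) (hE : (1 <= E)%N) (hED : (E <= D)%N)
  (A_ Q_ : nat -> 'M[R]_(M, N)) (R_ : nat -> 'M[R]_N) :
  let AD := mxpoly_sum D A_ in
  let dA := mxpoly_sum E (fun d => A_ (D + d)%N) in
  let QD := mxpoly_sum D Q_ in
  let RD := mxpoly_sum D R_ in
  QD *m RD =[D] AD ->
  QD^T *m QD =[D] 1%:M ->
  hadamard (PL R N) RD =[D] 0 ->
  R_ 0%N \in unitmx ->
  (exists! s : lifting R M N, lifting_steps D E AD dA QD RD s) /\
  (forall s : lifting R M N, lifting_steps D E AD dA QD RD s ->
    let ADE := AD + 'X^D *: dA in
    let QDE := QD + 'X^D *: l_dQ s in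
    let RDE := RD + 'X^D *: l_dR s in
    [/\ QDE *m RDE =[D + E] ADE,
        QDE^T *m QDE =[D + E] 1%:M
      & hadamard (PL R N) RDE =[D + E] 0]).
Proof.
move=> AD dA QD RD eqQR orthQ upR unitR0.
have hD : (0 < D)%N := leq_trans hE hED.
(* The entries have degree below [D], so vanishing modulo [t^D] is exact vanishing; the conclusion
   needs it up to order [D + E]. *)
have upRD : hadamard (PL R N) RD = 0.
  apply: (mxdeg_lt_inj _ _ upR) => i j; rewrite mxE ?size_poly0 //.
  exact: leq_trans (size_scale_leq _ _) (mxpoly_sum_deg _ _ i j).
(* As [E] and [D] are positive, this constant coefficient is [R_ 0]. *)
have unitRD0 : mxcoef 0 (mxtrunc E RD) \in unitmx.
  by rewrite mxtrunc_mod // mxcoef0_sum.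
have [s stepsS] := lifting_steps_exists dA eqQR orthQ unitRD0.
split; last by move=> s'; apply: lifting_steps_correct.
by exists s; split=> // s'; apply: lifting_steps_unique.
Qed.
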